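(* Let $G$ be a graph of order $n_0$ and size $m_0$, and let $k\ge 1$. Suppose $\mathcal{L}^k(G)$ has property $\varrho$ and the multiplicity of $-2$ as an eigenvalue of $\mathcal{L}^k(G)$ is $m_{k-1}-n_{k-1}$. Then $$\mathcal{E}\big(Ebd(\overline{\mathcal{L}^k(G)})\big)=2\big(2(\overline{\lambda}_{k(1)}+1)+3m_{k-1}-4n_{k-1}\big).$$ Consequently, among all such graphs $G$ with the same $n_{k-1}$ and $m_{k-1}$, the graphs $Ebd(\overline{\mathcal{L}^k(G)})$ are mutually equienergetic if and only if the graphs $\overline{\mathcal{L}^k(G)}$ have the same spectral radius.
   Context: $\mathcal{L}^k(G)$ is the $k$-th iterated line graph, of order $n_k$ and size $m_k$; $\overline{X}$ is the complement; $\overline{\lambda}_{k(1)}$ is the largest adjacency eigenvalue of $\overline{\mathcal{L}^k(G)}$. Property $\varrho$: all negative adjacency eigenvalues equal $-2$. For a graph $X$ with vertices $v_1,\dots,v_N$, $Ebd(X)$ is the bipartite graph with parts $\{x_i\}$, $\{y_i\}$ and $x_i\sim y_j$ iff $i=j$ or $v_iv_j\in E(X)$. Energy is the sum of absolute values of adjacency eigenvalues. *)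

(* Defs.v *)
From HB Require Import structures.
From mathcomp Require Import all_boot all_order all_algebra.

Set Implicit Arguments.
Unset Strict Implicit.
Unset Printing Implicit Defensive.

Import Order.TTheory GRing.Theory Num.Theory.
Local Open Scope ring_scope.

Record sgraph := SGraph {
  vert : finType;
  adj : rel vert;
  adj_sym : symmetric adj;
  adj_irr : irreflexive adj
}.

Definition edges (G : sgraph) : {set {set vert G}} :=
  [set e | [exists x, exists y, adj x y && (e == [set x; y])]].

Definition gorder (G : sgraph) : nat := #|vert G|.
Definition gsize (G : sgraph) : nat := #|edges G|.

Section LineGraph.
Variable G : sgraph.

Definition line_vert := {e : {set vert G} | e \in edges G}.

Definition line_adj : rel line_vert :=
  fun e f => (e != f) && (val e :&: val f != set0).

Lemma line_adj_sym : symmetric line_adj.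
Proof. by move=> e f; rewrite /line_adj eq_sym setIC. Qed.

Lemma line_adj_irr : irreflexive line_adj.
Proof. by move=> e; rewrite /line_adj eqxx. Qed.

Definition line_graph : sgraph := SGraph line_adj_sym line_adj_irr.
End LineGraph.

Definition iter_line (k : nat) (G : sgraph) : sgraph := iter k line_graph G.

Section Complement.
Variable G : sgraph.

Definition compl_adj : rel (vert G) := fun x y => (x != y) && ~~ adj x y.

Lemma compl_adj_sym : symmetric compl_adj.
Proof. by move=> x y; rewrite /compl_adj eq_sym adj_sym. Qed.

Lemma compl_adj_irr : irreflexive compl_adj.
Proof. by move=> x; rewrite /compl_adj eqxx. Qed.

Definition complement : sgraph := SGraph compl_adj_sym compl_adj_irr.
End Complement.

Section ExtendedBipartiteDouble.
Variable G : sgraph.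

Definition Ebd_adj : rel (vert G + vert G)%type := fun u v =>
  match u, v with
  | inl x, inr y | inr x, inl y => (x == y) || adj x y
  | _, _ => false
  end.

Lemma Ebd_adj_sym : symmetric Ebd_adj.
Proof. by case=> x [] y //=; rewrite eq_sym adj_sym. Qed.

Lemma Ebd_adj_irr : irreflexive Ebd_adj.
Proof. by case. Qed.

Definition Ebd : sgraph := SGraph Ebd_adj_sym Ebd_adj_irr.
End ExtendedBipartiteDouble.

(* C plays the role of the complex numbers.  The order of a
   numClosedFieldType is partial (x <= y iff y - x is real and nonnegative),
   but the eigenvalues of an adjacency matrix are real, hence comparable. *)
Section Spectrum.
Variable C : numClosedFieldType.

Definition adj_matrix (G : sgraph) : 'M[C]_#|vert G| :=
  \matrix_(i, j) (adj (enum_val i) (enum_val j))%:R.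

(* The roots of the characteristic polynomial, repeated according to
   multiplicity, in unspecified order. *)
Definition spectrum (G : sgraph) : seq C :=
  sval (closed_field_poly_normal (char_poly (adj_matrix G))).

Lemma spectrumE (G : sgraph) :
  char_poly (adj_matrix G) = \prod_(z <- spectrum G) ('X - z%:P).
Proof.
rewrite /spectrum; case: closed_field_poly_normal => s /= {1}->.
by rewrite (monicP (char_poly_monic _)) scale1r.
Qed.

Definition multiplicity (x : C) (G : sgraph) : nat := count_mem x (spectrum G).

Definition energy (G : sgraph) : C := \sum_(x <- spectrum G) `|x|.

(* The value on the graph without vertices is 0, an arbitrary convention. *)
Definition max_eigenvalue (G : sgraph) : C :=
  \big[Num.max/head 0 (spectrum G)]_(x <- spectrum G) x.

Definition spectral_radius (G : sgraph) : C :=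
  \big[Num.max/0]_(x <- spectrum G) `|x|.

Definition property_rho (G : sgraph) : Prop :=
  forall x, x \in spectrum G -> x < 0 -> x = - 2.

Definition equienergetic (G H : sgraph) : Prop :=
  gorder G = gorder H /\ energy G = energy H.

(* The difference is taken in int: truncated subtraction on nat would admit
   graphs with m_{k-1} < n_{k-1}. *)
Definition admissible (k : nat) (G : sgraph) : Prop :=
  property_rho (iter_line k G) /\
  Posz (multiplicity (- 2) (iter_line k G)) =
    Posz (gsize (iter_line k.-1 G)) - Posz (gorder (iter_line k.-1 G)).

End Spectrum.

(* Main.v *)
Require Import Defs.
From HB Require Import structures.
From mathcomp Require Import all_boot all_order all_algebra.
From mathcomp Require Import ring.

Set Implicit Arguments.
Unset Strict Implicit.
Unset Printing Implicit Defensive.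

Import Order.TTheory GRing.Theory Num.Theory.
Local Open Scope ring_scope.
Local Open Scope sesquilinear_scope.

(* Let [A] be the adjacency matrix of [L], the [k]-th iterated line graph, with
   [m] vertices, and let [r = m_{k-1} - n_{k-1}] be the multiplicity of its
   eigenvalue [-2].  The energy of [Ebd] of the complement is twice the sum of
   the moduli of the eigenvalues of [J - A], where [J] is the all-ones matrix,
   and these eigenvalues sum to [m].  So it suffices to know the positive ones.
   Eigenvectors of a line graph for [-2] are orthogonal to the all-ones vector,
   which gives [J - A] the eigenvalue [2] with multiplicity at least [r]; since
   [J] has rank one and all other eigenvalues of [-A] are nonpositive, [J - A]
   has at most [r + 1] positive eigenvalues.  By the Perron-Frobenius argument
   the largest eigenvalue of [J - A] has a nonnegative eigenvector, hence is not
   accounted for by those [r] copies of [2].  The positive eigenvalues are thus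
   [2], [r] times, and the largest one. *)

(** * Diagonal matrices, unitary diagonalisation and Rayleigh quotients *)

(** A sum of one rank-one matrix per nonzero entry gives the upper bound. For the lower bound,
    adding the indicator [d0] of the zero entries makes the matrix invertible, and rank is
    subadditive. *)
Lemma rank_diag_mx (F : fieldType) (n : nat) (d : 'rV[F]_n) :
  \rank (diag_mx d) = #|[pred i | d 0 i != 0]|.
Proof.
have rank_le (e : 'rV[F]_n) :
    (\rank (diag_mx e) <= #|[pred i | e 0%R i != 0%R]|)%N.
  have -> : diag_mx e = \sum_i e 0 i *: delta_mx i i.
    apply/matrixP=> i j; rewrite summxE (bigD1 i) //= big1 => [|k nki].
      rewrite !mxE eqxx addr0 eq_sym.
      by case: (j == i); rewrite ?mulr0n ?mulr1n ?mulr0 ?mulr1.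
    by rewrite !mxE [i == k]eq_sym (negPf nki) mulr0.
  rewrite -sum1_card [leqRHS]big_mkcond /=.
  apply: (big_ind2 (fun (M : 'M_n) k => (\rank M <= k)%N))
    => [|M a N b ha hb|i _]; first by rewrite mxrank0.
    exact: leq_trans (mxrank_add _ _) (leq_add ha hb).
  rewrite inE /=; case: eqVneq => [->|_]; first by rewrite scale0r mxrank0.
  by rewrite (leq_trans (mxrank_scale _ _)) // mxrank_delta.
apply/eqP; rewrite eqn_leq rank_le /=.
pose d0 : 'rV[F]_n := \row_i (d 0 i == 0)%:R.
pose u := d0 + d.
have unit_u : \rank (diag_mx u) = n.
  apply/mxrank_unit; rewrite unitmxE det_diag unitfE; apply/prodf_neq0=> i _.
  by rewrite !mxE; case: (d 0 i =P 0) => [->|/eqP];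
     rewrite ?addr0 ?add0r ?oner_eq0.
have : (n <= \rank (diag_mx d0) + \rank (diag_mx d))%N.
  by rewrite -{1}unit_u /u raddfD mxrank_add.
have card_d0 : #|[pred i | d0 0 i != 0]| = #|[pred i | d 0 i == 0]|.
  apply: eq_card=> i; rewrite !inE mxE.
  by case: (d 0 i == 0); rewrite ?oner_eq0 ?eqxx.
have := rank_le d0; rewrite card_d0 => le0 le1.
have := cardC [pred i | d 0 i == 0]; rewrite card_ord => card_n.
move: le1; rewrite -{1}card_n => le1.
have {le1 le0} := leq_trans le1 (leq_add le0 (leqnn _)).
by rewrite leq_add2l.
Qed.

(** Vectors act as rows: the rows of [P] form an orthonormal eigenbasis, and [v *m P^t*] lists the
    coordinates of [v] in it. *)
Definition unitary_diag (C : numClosedFieldType) (n : nat)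
    (M P : 'M[C]_n) (d : 'rV[C]_n) : Prop :=
  P \is unitarymx /\ M = P^t* *m diag_mx d *m P.

Lemma mulmx_trC_sqnorm (C : numClosedFieldType) (n : nat) (v : 'rV[C]_n) :
  (v *m v^t*) 0 0 = \sum_i `|v 0 i| ^+ 2.
Proof. by rewrite mxE; apply: eq_bigr=> i _; rewrite !mxE normCK. Qed.

Lemma quadratic_form_diag (C : numClosedFieldType) (n : nat)
    (M P : 'M[C]_n) (d v : 'rV[C]_n) : unitary_diag M P d ->
  (v *m M *m v^t*) 0 0 = \sum_i d 0 i * `|(v *m P^t*) 0 i| ^+ 2.
Proof.
case=> _ ->; set y := v *m P^t*.
have -> : v *m (P^t* *m diag_mx d *m P) *m v^t* = y *m diag_mx d *m y^t*.
  by rewrite /y trmx_mul map_mxM trmxCK !mulmxA.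
rewrite mxE; apply: eq_bigr=> i _.
by rewrite mul_mx_diag !mxE normCK mulrC mulrCA mulrA mulrC mulrA.
Qed.

Lemma sqnorm_unitary (C : numClosedFieldType) (n : nat) (P : 'M[C]_n)
    (v : 'rV[C]_n) : P \is unitarymx ->
  \sum_i `|(v *m P^t*) 0 i| ^+ 2 = \sum_i `|v 0 i| ^+ 2.
Proof.
move=> hP; rewrite -!mulmx_trC_sqnorm trmx_mul map_mxM trmxCK mulmxA.
by rewrite mulmxKtV.
Qed.

Lemma row_unitary_diag (C : numClosedFieldType) (n : nat)
    (M P : 'M[C]_n) (d : 'rV[C]_n) i : unitary_diag M P d ->
  row i P *m M = d 0 i *: row i P.
Proof.
case=> hP ->; rewrite !mulmxA -row_mul (unitarymxP _) // row1 -rowE row_diag_mx.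
by rewrite -scalemxAl -rowE.
Qed.

Lemma row_unitary_neq0 (C : numClosedFieldType) (n : nat) (P : 'M[C]_n) i :
  P \is unitarymx -> row i P != 0.
Proof.
move=> hP; apply/negP=> /eqP r0.
have /matrixP/(_ i i) := unitarymxP hP.
rewrite !mxE eqxx big1 => [/eqP|j _]; first by rewrite eq_sym oner_eq0.
by have /rowP/(_ j) := r0; rewrite !mxE => ->; rewrite mul0r.
Qed.

Lemma sqnorm_eq0 (C : numClosedFieldType) (n : nat) (v : 'rV[C]_n) :
  \sum_i `|v 0 i| ^+ 2 = 0 -> v = 0.
Proof.
move/psumr_eq0P=> h; apply/rowP=> i; rewrite mxE.
have /eqP := h (fun i _ => exprn_ge0 2 (normr_ge0 (v 0 i))) i isT.
by rewrite sqrf_eq0 normr_eq0 => /eqP.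
Qed.

Lemma rayleigh_le (C : numClosedFieldType) (n : nat)
    (M P : 'M[C]_n) (d : 'rV[C]_n) mu (v : 'rV[C]_n) :
  unitary_diag M P d -> (forall i, d 0 i <= mu) ->
  (v *m M *m v^t*) 0 0 <= mu * \sum_i `|v 0 i| ^+ 2.
Proof.
move=> hM le_mu; rewrite (quadratic_form_diag v hM).
rewrite -(sqnorm_unitary v hM.1) mulr_sumr.
by apply: ler_sum=> i _; rewrite ler_wpM2r ?exprn_ge0.
Qed.

(** At equality the nonnegative terms [(mu - d_i) |y_i|^2] sum to zero, so the coordinates [y] of
    [v] live only where [d_i = mu]. *)
Lemma rayleigh_eq (C : numClosedFieldType) (n : nat)
    (M P : 'M[C]_n) (d : 'rV[C]_n) mu (v : 'rV[C]_n) :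
  unitary_diag M P d -> (forall i, d 0 i <= mu) ->
  (v *m M *m v^t*) 0 0 = mu * \sum_i `|v 0 i| ^+ 2 -> v *m M = mu *: v.
Proof.
move=> hM le_mu; rewrite (quadratic_form_diag v hM).
rewrite -(sqnorm_unitary v hM.1) mulr_sumr => /eqP.
rewrite eq_sym -subr_eq0 -sumrB => /eqP/psumr_eq0P h0.
set y := v *m P^t* in h0.
have hy i : y 0 i * d 0 i = mu * y 0 i.
  have /(_ _ i isT)/eqP := h0; rewrite -mulrBl mulf_eq0 sqrf_eq0 normr_eq0.
  case/(_ _)/orP => [j _||/eqP->]; last by rewrite mul0r mulr0.
    by rewrite -mulrBl mulr_ge0 ?exprn_ge0 ?subr_ge0.
  by rewrite subr_eq0 => /eqP->; rewrite mulrC.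
case: hM => hP ->; rewrite -{2}[v](mulmxKtV _ hP) // -/y !mulmxA -/y.
rewrite scalemxAl; congr (_ *m _).
by apply/rowP=> i; rewrite mul_mx_diag mxE [RHS]mxE hy.
Qed.

(** * Perron-Frobenius bounds for nonnegative matrices *)

(* Replacing an eigenvector by its entrywise modulus cannot decrease the
   quadratic form of a nonnegative matrix. *)
Lemma normmx_form_ge (C : numClosedFieldType) (n : nat)
    (M : 'M[C]_n) nu (v : 'rV[C]_n) :
  (forall i j, 0 <= M i j) -> v *m M = nu *: v ->
  `|nu| * \sum_i `|v 0 i| ^+ 2 <=
    (map_mx Num.norm v *m M *m (map_mx Num.norm v)^t*) 0 0.
Proof.
move=> M0 vM.
(* For an eigenvector the left side is the modulus of the form at [v]; the triangle inequality then
   moves the modulus onto the entries. *)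
have -> : `|nu| * \sum_i `|v 0 i| ^+ 2 = `|(v *m M *m v^t*) 0 0|.
  rewrite vM -scalemxAl mxE mulmx_trC_sqnorm normrM; congr (_ * _).
  by rewrite ger0_norm // sumr_ge0 // => i _; rewrite exprn_ge0.
rewrite mxE (le_trans (ler_norm_sum _ _ _)) // mxE; apply: ler_sum=> i _.
rewrite !mxE normrM norm_conjC (conj_Creal (normr_real _)) ler_wpM2r //.
rewrite (le_trans (ler_norm_sum _ _ _)) //; apply: ler_sum=> j _.
by rewrite !mxE normrM [`|M _ _|]ger0_norm.
Qed.

Lemma sqnorm_normmx (C : numClosedFieldType) (n : nat) (v : 'rV[C]_n) :
  \sum_i `|(map_mx Num.norm v) 0 i| ^+ 2 = \sum_i `|v 0 i| ^+ 2.
Proof. by apply: eq_bigr=> i _; rewrite mxE normr_id. Qed.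

(** For an eigenvector of [d 0 i], the form at its modulus vector is at least [|d 0 i|] and at most
    [mu] times the squared norm. *)
Lemma nonneg_eigenvalue_norm_le (C : numClosedFieldType) (n : nat)
    (M P : 'M[C]_n) (d : 'rV[C]_n) mu :
  unitary_diag M P d -> (forall i j, 0 <= M i j) ->
  (forall i, d 0 i <= mu) -> forall i, `|d 0 i| <= mu.
Proof.
move=> hM M0 le_mu i; have := row_unitary_diag i hM.
have := row_unitary_neq0 i hM.1; move: (row i P) => v v0 vM.
have := le_trans (normmx_form_ge M0 vM)
  (rayleigh_le (map_mx Num.norm v) hM le_mu).
rewrite sqnorm_normmx ler_pM2r // lt_def; apply/andP; split.
  by apply: contra v0 => /eqP/sqnorm_eq0->.
by apply: sumr_ge0=> j _; rewrite exprn_ge0.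
Qed.

(** The modulus vector attains the Rayleigh bound, so the equality case applies to it. *)
Lemma nonneg_max_eigenvector (C : numClosedFieldType) (n : nat)
    (M P : 'M[C]_n) (d : 'rV[C]_n) mu (v : 'rV[C]_n) :
  unitary_diag M P d -> (forall i j, 0 <= M i j) ->
  (forall i, d 0 i <= mu) -> 0 <= mu -> v *m M = mu *: v ->
  map_mx Num.norm v *m M = mu *: map_mx Num.norm v.
Proof.
move=> hM M0 le_mu mu0 vM; apply: (rayleigh_eq hM le_mu).
apply/eqP; rewrite eq_le (rayleigh_le _ hM le_mu) /=.
by rewrite sqnorm_normmx -[X in X * _](ger0_norm mu0) normmx_form_ge.
Qed.

(** * Eigenspaces, traces and characteristic polynomials *)

(** [M - mu] is the diagonal matrix of [d - mu] between invertible factors, so its nullity is read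
    off the diagonal. *)
Lemma rank_eigenspace_diag (C : numClosedFieldType) (n : nat)
    (M P : 'M[C]_n) (d : 'rV[C]_n) mu : unitary_diag M P d ->
  \rank (eigenspace M mu) = #|[pred i | d 0 i == mu]|.
Proof.
case=> hP ->; have uP := unitarymx_unit hP.
have -> : eigenspace (P^t* *m diag_mx d *m P) mu =
          kermx (P^t* *m diag_mx (d - const_mx mu) *m P).
  rewrite /eigenspace raddfB /= mulmxBr mulmxBl diag_const_mx mul_mx_scalar.
  rewrite -scalemxAl -invmx_unitary // mulVmx //.
  by rewrite scalemx1.
rewrite mxrank_ker mxrankMfree ?row_free_unit //.
rewrite -mxrank_tr trmx_mul mxrankMfree; last first.
  by rewrite row_free_unit unitmx_tr -invmx_unitary // unitmx_inv.
rewrite mxrank_tr rank_diag_mx -{1}[n]card_ord.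
rewrite -(cardC [pred i | (d - const_mx mu) 0 i != 0]) addKn.
by apply: eq_card=> i; rewrite !inE negbK !mxE subr_eq0.
Qed.

Lemma trace_unitary_diag (C : numClosedFieldType) (n : nat)
    (M P : 'M[C]_n) (d : 'rV[C]_n) : unitary_diag M P d ->
  \sum_i d 0 i = \tr M.
Proof.
case=> hP ->.
by rewrite mxtrace_mulC mulmxA (unitarymxP hP) mul1mx mxtrace_diag.
Qed.

(** Multiplicativity of the determinant lets [\det V] cancel. Asking only that [V] be invertible
    allows eigenvectors that are not normalised. *)
Lemma char_poly_similar_diag (F : fieldType) (n : nat) (M V : 'M[F]_n)
    (d : 'rV[F]_n) : V \in unitmx -> V *m M = diag_mx d *m V ->
  char_poly M = \prod_i ('X - (d 0 i)%:P).
Proof.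
move=> uV VM.
have -> : char_poly M = char_poly (diag_mx d).
  have detV : \det (map_mx polyC V) != 0.
    by rewrite det_map_mx polyC_eq0 -unitfE -unitmxE.
  apply: (mulfI detV); rewrite /char_poly -det_mulmx [RHS]mulrC -det_mulmx.
  congr (\det _); rewrite /char_poly_mx mulmxBr mulmxBl -!map_mxM VM.
  by rewrite scalar_mxC.
rewrite char_poly_trig ?diag_mx_is_trig //.
by apply: eq_bigr=> i _; rewrite mxE eqxx mulr1n.
Qed.

Lemma spectrum_similar_diag (C : numClosedFieldType) (G : sgraph)
    (V : 'M[C]_#|vert G|) (d : 'rV[C]_#|vert G|) :
  V \in unitmx -> V *m adj_matrix C G = diag_mx d *m V ->
  perm_eq (spectrum C G) [seq d 0 i | i <- enum 'I_#|vert G|].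
Proof.
move=> uV VM; apply: prod_XsubC_eq; rewrite -spectrumE.
by rewrite (char_poly_similar_diag uV VM) big_map big_enum.
Qed.

(** * Adjacency spectra *)

(** Indexed by the rows of a unitary eigenbasis, this ties each eigenvalue to an eigenvector, which
    the bare root list [spectrum] does not. *)
Definition eigenvalues (C : numClosedFieldType) (G : sgraph) :
  'rV[C]_#|vert G| := spectral_diag (adj_matrix C G).

Lemma adj_matrix_hermsym (C : numClosedFieldType) (G : sgraph) :
  adj_matrix C G \is hermsymmx.
Proof.
apply: realsym_hermsym.
  apply/is_hermitianmxP; rewrite expr0 scale1r map_mx_id //.
  by apply/matrixP=> i j; rewrite !mxE adj_sym.
by apply/mxOverP=> i j; rewrite mxE realn.
Qed.

Lemma eigenvalues_unitary_diag (C : numClosedFieldType) (G : sgraph) :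
  unitary_diag (adj_matrix C G) (spectralmx (adj_matrix C G)) (eigenvalues C G).
Proof.
split; first exact: spectral_unitarymx.
rewrite -invmx_unitary ?spectral_unitarymx //; apply/orthomx_spectralP.
exact/hermitian_normalmx/adj_matrix_hermsym.
Qed.

Lemma eigenvalues_real (C : numClosedFieldType) (G : sgraph) i :
  eigenvalues C G 0 i \is Num.real.
Proof.
exact: (mxOverP (hermitian_spectral_diag_real (adj_matrix_hermsym C G))).
Qed.

Lemma perm_spectrum_eigenvalues (C : numClosedFieldType) (G : sgraph) :
  perm_eq (spectrum C G)
    [seq eigenvalues C G 0 i | i <- enum 'I_#|vert G|].
Proof.
have [hP hM] := eigenvalues_unitary_diag C G.
apply: (spectrum_similar_diag (unitarymx_unit hP)).
by rewrite {2}hM !mulmxA (unitarymxP hP) mul1mx.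
Qed.

Lemma mem_spectrumP (C : numClosedFieldType) (G : sgraph) x :
  reflect (exists i, x = eigenvalues C G 0 i) (x \in spectrum C G).
Proof.
rewrite (perm_mem (perm_spectrum_eigenvalues C G)).
apply: (iffP mapP) => [[i _ ->]|[i ->]]; first by exists i.
by exists i; rewrite // mem_enum.
Qed.

Lemma multiplicityE (C : numClosedFieldType) (G : sgraph) x :
  multiplicity x G = #|[pred i | eigenvalues C G 0 i == x]|.
Proof.
rewrite /multiplicity (permP (perm_spectrum_eigenvalues C G)) count_map.
by rewrite [RHS]cardE {2}/enum_mem size_filter enumT; apply: eq_count.
Qed.

Lemma sum_eigenvalues (C : numClosedFieldType) (G : sgraph) :
  \sum_i eigenvalues C G 0 i = 0.
Proof.
rewrite (trace_unitary_diag (eigenvalues_unitary_diag C G)).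
by apply: big1=> i _; rewrite mxE adj_irr.
Qed.

(** * Largest eigenvalue and spectral radius *)

(** The order on [C] is partial, so all values must be real for the maximum to behave as usual. The
    start value [x0] competes too, hence [x0 :: s]. *)
Lemma bigmax_realP (C : numClosedFieldType) (x0 : C) (s : seq C) :
  {in x0 :: s, forall x, x \is Num.real} ->
  \big[Num.max/x0]_(x <- s) x \in x0 :: s /\
  {in x0 :: s, forall x, x <= \big[Num.max/x0]_(x <- s) x}.
Proof.
elim: s => [|y s IHs] reals.
  by rewrite big_nil mem_head; split=> // x; rewrite inE => /eqP->.
have [|max_in max_ge] := IHs.
  by move=> x; rewrite inE => /orP[/eqP->|xs]; apply: reals;
     rewrite !inE ?eqxx ?xs ?orbT.
rewrite big_cons; move: (\big[_/_]_(_ <- _) _) max_in max_ge => m m_in m_ge.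
have y_real : y \is Num.real by apply: reals; rewrite !inE eqxx orbT.
have m_real : m \is Num.real.
  by apply: reals; move: m_in; rewrite !inE => /orP[->|->]; rewrite ?orbT.
have [le_ym|lt_my] := real_leP y_real m_real.
  split=> [|x]; first by move: m_in; rewrite !inE => /orP[->|->]; rewrite ?orbT.
  rewrite inE => /orP[/eqP->|]; first by apply: m_ge; rewrite mem_head.
  by rewrite inE => /orP[/eqP->//|xs]; apply: m_ge; rewrite inE xs orbT.
split=> [|x]; first by rewrite !inE eqxx orbT.
move=> xs; have [->//|ne_xy] := eqVneq x y.
apply: le_trans (ltW lt_my); apply: m_ge.
by move: xs; rewrite !inE (negPf ne_xy).
Qed.

Lemma max_eigenvalueP (C : numClosedFieldType) (G : sgraph) :
  (0 < gorder G)%N ->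
  (exists i, max_eigenvalue C G = eigenvalues C G 0 i) /\
  forall i, eigenvalues C G 0 i <= max_eigenvalue C G.
Proof.
move=> G_gt0; pose s := spectrum C G.
(* With at least one vertex, the default value of the maximum is itself an eigenvalue. *)
have s_head : head 0 s \in s.
  have : size s = #|vert G|.
    rewrite (perm_size (perm_spectrum_eigenvalues C G)) size_map.
    by rewrite -cardE card_ord.
  move=> size_s; move: G_gt0; rewrite /gorder -size_s.
  by case: (s) => [//|x s'] _; rewrite mem_head.
have sub : {subset head 0 s :: s <= s}.
  by move=> x; rewrite inE => /orP[/eqP->|].
have [x /sub/mem_spectrumP[i ->]|max_in max_ge] := @bigmax_realP C (head 0 s) s.
  exact: eigenvalues_real.
split=> [|i]; first exact/mem_spectrumP/sub.
by apply: max_ge; rewrite inE; apply/orP; right; apply/mem_spectrumP; exists i.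
Qed.

(** The eigenvalues sum to the trace, zero, so they cannot all be negative. *)
Lemma max_eigenvalue_ge0 (C : numClosedFieldType) (G : sgraph) :
  (0 < gorder G)%N -> 0 <= max_eigenvalue C G.
Proof.
move=> G_gt0; have [[i0 max_i0] max_ge] := max_eigenvalueP C G_gt0.
have max_real : max_eigenvalue C G \is Num.real.
  by rewrite max_i0 eigenvalues_real.
rewrite real_leNgt ?real0 //; apply/negP=> max_lt0.
have : \sum_i eigenvalues C G 0 i <= \sum_(i < #|vert G|) max_eigenvalue C G.
  by apply: ler_sum.
rewrite sum_eigenvalues sumr_const card_ord => /le_gtF.
by rewrite -[_ *+ _]mulr_natr nmulr_rlt0 // ltr0n [(0 < _)%N]G_gt0.
Qed.

Lemma adj_matrix_ge0 (C : numClosedFieldType) (G : sgraph) i j :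
  0 <= adj_matrix C G i j.
Proof. by rewrite mxE ler0n. Qed.

(** By Perron-Frobenius the largest eigenvalue bounds every modulus; being nonnegative, it is also
    one of the moduli. *)
Lemma spectral_radiusE (C : numClosedFieldType) (G : sgraph) :
  (0 < gorder G)%N -> spectral_radius C G = max_eigenvalue C G.
Proof.
move=> G_gt0; have [[i0 max_i0] max_ge] := max_eigenvalueP C G_gt0.
have norm_le := nonneg_eigenvalue_norm_le (eigenvalues_unitary_diag C G)
  (@adj_matrix_ge0 C G) max_ge.
rewrite /spectral_radius -(big_map Num.norm xpredT id).
have [x|r_in r_ge] := @bigmax_realP C 0 [seq `|x| | x <- spectrum C G].
  by rewrite inE => /orP[/eqP->|/mapP[y _ ->]]; rewrite ?real0 ?normr_real.
apply/eqP; rewrite eq_le; apply/andP; split.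
  move: r_in; rewrite inE => /orP[/eqP->|/mapP[x /mem_spectrumP[i ->] ->]].
    exact: max_eigenvalue_ge0.
  exact: norm_le.
rewrite max_i0 -[leLHS]ger0_norm; last first.
  by rewrite -max_i0 max_eigenvalue_ge0.
apply: r_ge; rewrite inE; apply/orP; right; apply/map_f/mem_spectrumP.
by exists i0.
Qed.

(** * Energy of the extended bipartite double *)

Lemma sum_enum_val_sum (R : nmodType) (T : finType) (F : (T + T)%type -> R) :
  \sum_(i < #|{: T + T}|) F (enum_val i) =
  \sum_(i < #|T|) F (inl (enum_val i)) + \sum_(i < #|T|) F (inr (enum_val i)).
Proof.
rewrite -big_enum_val big_sumType /= -(big_enum_val (fun x => F (inl x))).
by rewrite -(big_enum_val (fun x => F (inr x))).
Qed.

(* If [P] diagonalises the adjacency matrix [M] of [G], then the rows of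
   [[P, P], [P, -P]] diagonalise the matrix [[0, 1 + M], [1 + M, 0]]. *)
Lemma energy_Ebd (C : numClosedFieldType) (G : sgraph) :
  energy C (Ebd G) = 2 * \sum_i `|eigenvalues C G 0 i + 1|.
Proof.
have hM := eigenvalues_unitary_diag C G.
set P := spectralmx _ in hM; set d := eigenvalues C G in hM *.
pose T := vert G.
(* [s] holds the signs of the four blocks, [e] forgets which copy a vertex lies in, and [D] lists
   the eigenvalues, [d + 1] and its opposite. *)
pose s (u v : T + T) : C :=
  match u, v with inr _, inr _ => -1 | _, _ => 1 end.
pose e (u : T + T) := match u with inl x | inr x => enum_rank x end.
pose V : 'M[C]_#|{: T + T}| := \matrix_(i, j)
  (s (enum_val i) (enum_val j) * P (e (enum_val i)) (e (enum_val j))).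
pose D (u : T + T) : C :=
  match u with inl x => d 0 (enum_rank x) + 1
             | inr x => - (d 0 (enum_rank x) + 1) end.
have PP x y : \sum_k P x k * (P y k)^* = (x == y)%:R.
  have /matrixP/(_ x y) := unitarymxP hM.1; rewrite !mxE => <-.
  by apply: eq_bigr=> k _; rewrite !mxE.
(* The disjunction is an entry of [1 + M]: no vertex is adjacent to itself, so its two cases never
   overlap. *)
have PM x y : \sum_k P x k * ((enum_val k == y) ||
    adj (enum_val k) y)%:R = (d 0 x + 1) * P x (enum_rank y).
  rewrite -[y in LHS]enum_rankK; move: (enum_rank y) => {}y.
  have /rowP/(_ y) := row_unitary_diag x hM; rewrite !mxE => eqd.
  rewrite mulrDl mul1r -eqd.
  rewrite -[P x y in RHS]mulr1 (bigD1 y) //= [in RHS](bigD1 y) //=.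
  rewrite !mxE eqxx adj_irr mulr0 add0r addrC; congr (_ + _).
  apply: eq_bigr=> k nky; rewrite !mxE (inj_eq enum_val_inj).
  by rewrite (negPf nky).
have uV : V \in unitmx.
  (* The rows of [V] are orthogonal of squared norm 2. *)
  have VV : V *m V^t* = 2%:M.
    apply/matrixP=> i j; rewrite mxE.
    under eq_bigr => k _ do rewrite !mxE.
    rewrite (sum_enum_val_sum (fun u => s (enum_val i) u *
      P (e (enum_val i)) (e u) *
      (s (enum_val j) u * P (e (enum_val j)) (e u))^*)).
    rewrite [RHS]mxE -(inj_eq enum_val_inj) /s /e.
    case: (enum_val i) => x; case: (enum_val j) => y /=;
    under eq_bigr => k _ do rewrite ?enum_valK ?(mul1r, mulN1r) ?rmorphN
      ?(mulrNN, mulrN, mulNr);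
    under [X in _ + X = _]eq_bigr => k _ do rewrite ?enum_valK
      ?(mul1r, mulN1r) ?rmorphN ?(mulrNN, mulrN, mulNr);
    rewrite ?sumrN !PP (inj_eq enum_rank_inj) ?subrr //.
    - by rewrite -mulr2n -[inl x == inl y]/(x == y) -mulrnA mulnC mulrnA.
    - by rewrite -mulr2n -[inr x == inr y]/(x == y) -mulrnA mulnC mulrnA.
  have : \det (V *m V^t*) != 0 by rewrite VV det_scalar expf_neq0 // pnatr_eq0.
  by rewrite det_mulmx mulf_eq0 negb_or unitmxE unitfE => /andP[].
have VM : V *m adj_matrix C (Ebd G) = diag_mx (\row_i D (enum_val i)) *m V.
  apply/matrixP=> i j; rewrite mul_diag_mx !mxE.
  under eq_bigr => k _ do rewrite !mxE.
  rewrite (sum_enum_val_sum (fun u => s (enum_val i) u *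
    P (e (enum_val i)) (e u) * (Ebd_adj u (enum_val j))%:R)).
  rewrite /s /e /D.
  case: (enum_val i) => x; case: (enum_val j) => y /=.
  - rewrite [X in X + _]big1 => [|k _]; last by rewrite mulr0.
    by rewrite add0r; under eq_bigr => k _ do rewrite enum_valK mul1r;
       rewrite PM mul1r.
  - rewrite [X in _ + X]big1 => [|k _]; last by rewrite mulr0.
    by rewrite addr0; under eq_bigr => k _ do rewrite enum_valK mul1r;
       rewrite PM mul1r.
  - rewrite [X in X + _]big1 => [|k _]; last by rewrite mulr0.
    by rewrite add0r; under eq_bigr => k _ do rewrite enum_valK mulN1r mulNr;
       rewrite sumrN PM mul1r mulNr.
  - rewrite [X in _ + X]big1 => [|k _]; last by rewrite mulr0.
    by rewrite addr0; under eq_bigr => k _ do rewrite enum_valK mul1r;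
       rewrite PM mulN1r mulrNN.
rewrite /energy (perm_big _ (@spectrum_similar_diag C (Ebd G) _ _ uV VM)).
rewrite big_map big_enum /=.
under eq_bigr => i _ do rewrite mxE.
rewrite (sum_enum_val_sum (fun u => `|D u|)) /D /=.
under eq_bigr => i _ do rewrite enum_valK.
under [X in _ + X = _]eq_bigr => i _ do rewrite enum_valK normrN.
by rewrite -mulr2n mulr_natl.
Qed.

(** * Line graphs and incidence matrices *)

Lemma gorder_line_graph (H : sgraph) : gorder (line_graph H) = gsize H.
Proof. by rewrite /gorder /= card_sig; apply: eq_card=> e; rewrite inE. Qed.

Lemma card_edge (H : sgraph) (e : line_vert H) : #|val e| = 2%N.
Proof.
have := valP e; rewrite inE => /existsP[x /existsP[y /andP[xy /eqP->]]].
by rewrite cards2; case: eqVneq xy => [->|//]; rewrite adj_irr.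
Qed.

(** An edge has two ends, and distinct edges share at most one of them. *)
Lemma card_edgeI (H : sgraph) (e f : line_vert H) :
  #|val e :&: val f| = ((adj (s := line_graph H) e f) + 2 * (e == f))%N.
Proof.
rewrite /= /line_adj; case: eqVneq => [->|ne_ef] /=.
  by rewrite setIid card_edge.
rewrite muln0 addn0 -card_gt0.
have : (#|val e :&: val f| <= 2)%N.
  by rewrite -(card_edge e) subset_leq_card ?subsetIl.
case card_ef: #|_| => [|[|[|n]]] // _; case/negP: ne_ef; apply/eqP/val_inj.
have /eqP <- : val e :&: val f == val e.
  by rewrite eqEcard subsetIl card_ef card_edge.
by apply/eqP; rewrite eqEcard subsetIr card_ef card_edge.
Qed.

Definition incidence_matrix (C : numClosedFieldType) (H : sgraph) :
    'M[C]_(#|vert (line_graph H)|, #|vert H|) :=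
  \matrix_(i, j) (enum_val j \in val (enum_val i : line_vert H))%:R.

Lemma adj_matrix_line_graph (C : numClosedFieldType) (H : sgraph) :
  adj_matrix C (line_graph H) + 2%:M =
  incidence_matrix C H *m (incidence_matrix C H)^t*.
Proof.
apply/matrixP=> i j; rewrite !mxE.
have -> : (adj (enum_val i) (enum_val j))%:R + 2 *+ (i == j) =
    #|val (enum_val i : line_vert H) :&:
      val (enum_val j : line_vert H)|%:R :> C.
  by rewrite card_edgeI natrD mulrnA (inj_eq enum_val_inj).
rewrite -sum1_card natr_sum big_mkcond /= big_enum_val /=.
apply: eq_bigr=> k _; rewrite !mxE inE conjC_nat.
by do 2!case: (_ \in _); rewrite ?mulr1 ?mulr0.
Qed.

Lemma incidence_matrix_sum (C : numClosedFieldType) (H : sgraph) :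
  incidence_matrix C H *m const_mx 1 = const_mx 2 :> 'cV_ _.
Proof.
apply/matrixP=> i j; rewrite !mxE -(card_edge (enum_val i)) -sum1_card natr_sum.
rewrite [RHS]big_mkcond [RHS]big_enum_val /=; apply: eq_bigr=> k _.
by rewrite !mxE mulr1; case: (_ \in _).
Qed.

(* [A + 2] is the Gram matrix of the incidence vectors, whose entries sum
   to 2. *)
Lemma line_graph_eigenvector_sum0 (C : numClosedFieldType) (H : sgraph)
    (v : 'rV[C]_#|vert (line_graph H)|) :
  v *m adj_matrix C (line_graph H) = - 2 *: v -> v *m (const_mx 1 : 'cV_ _) = 0.
Proof.
move=> vA; have : v *m (adj_matrix C (line_graph H) + 2%:M) = 0.
  by rewrite mulmxDr vA mul_mx_scalar scaleNr addNr.
rewrite adj_matrix_line_graph => vN.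
(* With [N] the incidence matrix, the squared norm of [v N] is [v N N^* v^*], which vanishes. *)
have /sqnorm_eq0 vN0 : \sum_i `|(v *m incidence_matrix C H) 0 i| ^+ 2 = 0.
  by rewrite -mulmx_trC_sqnorm trmx_mul map_mxM !mulmxA -[v *m _ *m _]mulmxA vN
             mul0mx mxE.
have : v *m (const_mx 2 : 'cV_ _) = 0.
  by rewrite -incidence_matrix_sum mulmxA vN0 mul0mx.
have -> : const_mx 2 = 2 *: const_mx 1 :> 'cV[C]_#|vert (line_graph H)|.
  by apply/matrixP=> i j; rewrite !mxE mulr1.
by rewrite -scalemxAr => /eqP; rewrite scalemx_eq0 pnatr_eq0 => /eqP.
Qed.

(** * Eigenvalues of complements *)

Lemma adj_matrix_complement (C : numClosedFieldType) (G : sgraph) :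
  adj_matrix C (complement G) =
  (const_mx 1 : 'cV_ _) *m (const_mx 1 : 'rV_ _) - adj_matrix C G - 1%:M.
Proof.
apply/matrixP=> i j; rewrite !mxE big_ord1 !mxE mulr1 /= /compl_adj.
rewrite (inj_eq enum_val_inj); case: eqVneq => [->|_] /=.
  by rewrite adj_irr subr0 subrr.
by case: adj; rewrite subr0 ?subrr ?subr0.
Qed.

Lemma mulmx_complement (C : numClosedFieldType) (G : sgraph)
    (v : 'rV[C]_#|vert G|) :
  v *m (const_mx 1 : 'cV_ _) = 0 ->
  v *m adj_matrix C (complement G) = - (v *m adj_matrix C G) - v.
Proof.
move=> v1; rewrite adj_matrix_complement !mulmxBr mulmxA v1 mul0mx sub0r.
by rewrite mulmx1.
Qed.

(* A vector in the span of the eigenvectors counted on the left that is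
   orthogonal to the all-ones vector and to the eigenvectors of [A] counted on
   the right must vanish: [J - A] is positive on it by the first property and
   nonpositive by the others. *)
Lemma card_eigenvalues_complement_gt (C : numClosedFieldType) (G : sgraph) :
  (#|[pred i | (0 < eigenvalues C (complement G) 0 i + 1)%R]| <=
   #|[pred i | (eigenvalues C G 0 i < 0)%R]|.+1)%N.
Proof.
have hA := eigenvalues_unitary_diag C G.
have hK := eigenvalues_unitary_diag C (complement G).
set PA := spectralmx _ in hA; set a := eigenvalues C G in hA *.
set PK := spectralmx (adj_matrix C (complement G)) in hK.
set d := eigenvalues C (complement G) in hK *.
pose n := #|vert G|.
(* [X] spans the eigenvectors of the complement with eigenvalue above -1, those positive for
   [J - A]. The kernel of [Q] is orthogonal to all-ones and to the eigenvectors of [A] with negative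
   eigenvalue. *)
pose X : 'M[C]_n := diag_mx (\row_i (0 < d 0 i + 1)%R%:R) *m PK.
pose N : 'M[C]_n := PA^t* *m diag_mx (\row_i (a 0 i < 0)%R%:R).
pose Q := row_mx N (const_mx 1 : 'cV_n).
have rkX : \rank X = #|[pred i | (0 < d 0 i + 1)%R]|.
  rewrite mxrankMfree ?row_free_unit ?unitarymx_unit ?hK.1 // rank_diag_mx.
  by apply: eq_card=> i; rewrite !inE mxE pnatr_eq0; case: (0 < _).
have rkN : (\rank N <= #|[pred i | (a 0%R i < 0)%R]|)%N.
  rewrite (leq_trans (mxrankM_maxr _ _)) // rank_diag_mx subset_leq_card //.
  by apply/subsetP=> i; rewrite !inE mxE pnatr_eq0; case: (_ < 0).
have rkQ : (\rank Q <= #|[pred i | (a 0%R i < 0)%R]|.+1)%N.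
  rewrite -mxrank_tr tr_row_mx -addsmxE -[leqRHS]addn1.
  rewrite (leq_trans (mxrank_adds_leqif _ _)) // leq_add ?mxrank_tr //.
  exact: rank_leq_col.
(* The rank of [X] is that of [X *m Q] plus the dimension of the part of its row space killed by
   [Q]. *)
rewrite -rkX -(mxrank_mul_ker X Q).
have -> : \rank (X :&: kermx Q)%MS = 0%N.
  apply/eqP; rewrite mxrank_eq0; apply/rowV0P=> v.
  rewrite sub_capmx => /andP[/submxP[w vX] /sub_kermxP].
  rewrite mul_mx_row -row_mx0 => /eq_row_mx[vN v1].
  have form_eq : (v *m adj_matrix C (complement G) *m v^t*) 0 0 +
      (v *m v^t*) 0 0 = - (v *m adj_matrix C G *m v^t*) 0 0.
    by rewrite mulmx_complement // mulmxBl mulNmx !mxE subrK.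
  rewrite (quadratic_form_diag v hK) (quadratic_form_diag v hA) in form_eq.
  rewrite mulmx_trC_sqnorm -(sqnorm_unitary v hK.1) -big_split /= in form_eq.
  have y0 i : ~~ (0 < d 0 i + 1) -> (v *m PK^t*) 0 i = 0.
    move=> /negPf h; rewrite vX /X mulmxA mulmxtVK ?hK.1 // mul_mx_diag !mxE h.
    by rewrite mulr0.
  have z0 i : a 0 i < 0 -> (v *m PA^t*) 0 i = 0.
    move=> h; move: vN; rewrite /N mulmxA mul_mx_diag => /rowP/(_ i).
    by rewrite !mxE h mulr1.
  have za : 0 <= \sum_i a 0 i * `|(v *m PA^t*) 0 i| ^+ 2.
    apply: sumr_ge0=> i _; case: (real_ltP (@eigenvalues_real C G i) (real0 C)).
      by move=> /z0->; rewrite normr0 expr0n mulr0.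
    by move=> h; rewrite mulr_ge0 ?exprn_ge0.
  have ya i : 0 <= d 0 i * `|(v *m PK^t*) 0 i| ^+ 2 + `|(v *m PK^t*) 0 i| ^+ 2.
    rewrite -{2}[_ ^+ 2]mul1r -mulrDl.
    case: (boolP (0 < d 0 i + 1)) => [h|/y0->].
      by rewrite mulr_ge0 ?exprn_ge0 // ltW.
    by rewrite normr0 expr0n mulr0.
  have sum0 : \sum_i (d 0 i * `|(v *m PK^t*) 0 i| ^+ 2 +
                      `|(v *m PK^t*) 0 i| ^+ 2) = 0.
    apply/eqP; rewrite eq_le sumr_ge0 ?andbT => [|i _]; last exact: ya.
    by rewrite form_eq oppr_le0.
  have /psumr_eq0P sum0' := sum0.
  apply: sqnorm_eq0; rewrite -(sqnorm_unitary v hK.1) big1 // => i _.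
  have /eqP := sum0' (fun i _ => ya i) i isT.
  rewrite -{2}[_ ^+ 2]mul1r -mulrDl mulf_eq0; case/orP=> [/eqP h|/eqP //].
  by rewrite y0 ?normr0 ?expr0n // h ltxx.
by rewrite addn0 (leq_trans (mxrankM_maxr _ _)).
Qed.

(** [J] kills these vectors, so [J - A - 1] acts on them as [2 - 1]. *)
Lemma eigenspace_line_complement (C : numClosedFieldType) (H : sgraph) :
  (eigenspace (adj_matrix C (line_graph H)) (- 2) <=
   eigenspace (adj_matrix C (complement (line_graph H))) 1)%MS.
Proof.
apply/rV_subP=> v /eigenspaceP vA; apply/eigenspaceP.
have v1 := line_graph_eigenvector_sum0 vA.
rewrite (mulmx_complement v1) [v *m _]vA scaleNr opprK.
by rewrite scaler_nat mulr2n addrK scale1r.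
Qed.

(* If all eigenvectors for the largest eigenvalue 1 of the complement came from
   the eigenvalue -2 of the line graph, they would be orthogonal to the all-ones
   vector, whereas one of them is nonnegative. *)
Lemma card_max_eigenvalue1 (C : numClosedFieldType) (H : sgraph)
    (K := complement (line_graph H)) i0 :
  (forall i, eigenvalues C K 0 i <= 1) -> eigenvalues C K 0 i0 = 1 ->
  (multiplicity (- 2 : C) (line_graph H) <
   #|[pred i | eigenvalues C K 0%R i == 1%R]|)%N.
Proof.
move=> le1 eq1; have hK := eigenvalues_unitary_diag C K.
have hA := eigenvalues_unitary_diag C (line_graph H).
rewrite multiplicityE -(rank_eigenspace_diag _ hA) -(rank_eigenspace_diag _ hK).
(* One eigenspace contains the other, so strictness means that the reverse inclusion fails. *)
rewrite (ltn_leqif (mxrank_leqif_sup (eigenspace_line_complement C H))).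
apply/negP=> /rV_subP sub.
pose v := row i0 (spectralmx (adj_matrix C K)); pose w := map_mx Num.norm v.
have vK : v *m adj_matrix C K = 1 *: v by rewrite -eq1; apply: row_unitary_diag.
have wK : w *m adj_matrix C K = 1 *: w.
  exact: (nonneg_max_eigenvector hK (@adj_matrix_ge0 C K) le1 ler01 vK).
have /sub/eigenspaceP/line_graph_eigenvector_sum0/matrixP/(_ 0 0) :
  (w <= eigenspace (adj_matrix C K) 1)%MS by apply/eigenspaceP.
(* The entries of [w] are nonnegative and sum to zero, which would force [v = 0]. *)
rewrite !mxE => /psumr_eq0P w0; case/negP: (row_unitary_neq0 i0 hK.1).
apply/eqP/rowP=> j; rewrite [RHS]mxE; apply/eqP; rewrite -normr_eq0; apply/eqP.
have /(_ _ j isT) := w0; rewrite !mxE mulr1; apply=> k _.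
by rewrite !mxE mulr1.
Qed.

(** * The energy formula and its consequence *)

Lemma energy_Ebd_complement_line (C : numClosedFieldType) (H : sgraph)
    (L := line_graph H) :
  property_rho C L -> (0 < gorder L)%N ->
  energy C (Ebd (complement L)) =
    2 * (2 * (max_eigenvalue C (complement L) + 1)
         + 4 * (multiplicity (- 2 : C) L)%:R - (gorder L)%:R).
Proof.
move=> rho L_gt0; set K := complement L; set r := multiplicity _ _.
have [[i0 max_i0] max_ge] := @max_eigenvalueP C K L_gt0.
have max_ge0 := @max_eigenvalue_ge0 C K L_gt0.
rewrite energy_Ebd; congr (2 * _).
have hK := eigenvalues_unitary_diag C K.
have hA := eigenvalues_unitary_diag C L.
set d := eigenvalues C K in hK max_i0 max_ge *.
pose Pos := [set i | 0 < d 0 i + 1]; pose S := [set i | d 0 i == 1].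
have r_le_S : (r <= #|S|)%N.
  rewrite /r multiplicityE -(rank_eigenspace_diag _ hA) cardsE.
  rewrite -(rank_eigenspace_diag 1 hK) mxrankS //.
  exact: eigenspace_line_complement.
(* Property rho turns the count of negative eigenvalues into the multiplicity [r] of -2. *)
have Pos_le : (#|Pos| <= r.+1)%N.
  rewrite cardsE (leq_trans (card_eigenvalues_complement_gt C L)) // ltnS.
  rewrite /r multiplicityE subset_leq_card //; apply/subsetP=> i; rewrite !inE.
  by move=> /rho->//; apply/mem_spectrumP; exists i.
have i0_Pos : i0 \in Pos by rewrite inE -max_i0 ltr_wpDl.
(* If the maximum is itself 1, discarding [i0] costs one element of [S], and the strict bound of
   [card_max_eigenvalue1] makes up for it. *)
have SD_ge : (r <= #|S :\ i0|)%N.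
  have := cardsD1 i0 S; rewrite inE; case: eqP => [eq1|_] /= cardS; last first.
    by move: r_le_S; rewrite cardS.
  rewrite -ltnS -[#|_|.+1]cardS [#|S|]cardsE.
  by apply: (card_max_eigenvalue1 _ eq1) => i; rewrite -eq1 -max_i0.
have PosD_le : (#|Pos :\ i0| <= r)%N.
  by move: Pos_le; rewrite (cardsD1 i0 Pos) i0_Pos.
have SD_sub : S :\ i0 \subset Pos :\ i0.
  apply/setSD/subsetP=> i; rewrite !inE => /eqP->.
  by rewrite addr_gt0 ?ltr01.
(* Both sets are squeezed to [r] elements, so every other positive eigenvalue of [J - A] is exactly
   2. *)
have /eqP eqSPos : S :\ i0 == Pos :\ i0.
  by rewrite eqEcard SD_sub (leq_trans PosD_le).
have cardPosD : #|Pos :\ i0| = r.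
  by apply/eqP; rewrite eqn_leq PosD_le -eqSPos.
have sumPos : \sum_(i in Pos) (d 0 i + 1) = max_eigenvalue C K + 1 + 2 * r%:R.
  rewrite (big_setD1 i0) //= -max_i0; congr (_ + _).
  rewrite (eq_bigr (fun=> 2)) => [|i].
    by rewrite sumr_const cardPosD mulr_natr.
  by rewrite -eqSPos !inE => /andP[_ /eqP->].
(* Writing [|b|] as twice the positive part of [b] minus [b] leaves only the positive eigenvalues
   and the trace to sum. *)
have normE i : `|d 0 i + 1| =
    2 * (if i \in Pos then d 0 i + 1 else 0) - (d 0 i + 1).
  have b_real : d 0 i + 1 \is Num.real.
    by rewrite realD ?real1 // eigenvalues_real.
  rewrite inE; case: (real_ltP (real0 C) b_real) => [/gtr0_norm->|/ler0_norm->].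
    by ring.
  by rewrite mulr0 sub0r.
have sum_b : \sum_i (d 0 i + 1) = (gorder L)%:R.
  by rewrite big_split sum_eigenvalues sumr_const card_ord; apply: add0r.
rewrite (eq_bigr _ (fun i _ => normE i)) sumrB sum_b -mulr_sumr -big_mkcond.
by rewrite sumPos; ring.
Qed.

Theorem theorem6p2 (C : numClosedFieldType) (k : nat) (hk : (1 <= k)%N) :
  (forall G : sgraph,
     admissible C k G ->
     (0 < gorder (iter_line k G))%N ->
     energy C (Ebd (complement (iter_line k G))) =
       2 * (2 * (max_eigenvalue C (complement (iter_line k G)) + 1)
            + 3 * (gsize (iter_line k.-1 G))%:R
            - 4 * (gorder (iter_line k.-1 G))%:R))
  /\
  (forall (n m : nat) (F : sgraph -> Prop),
     (forall G, F G ->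
        [/\ admissible C k G,
            gorder (iter_line k.-1 G) = n &
            gsize (iter_line k.-1 G) = m]) ->
     ((forall G H, F G -> F H ->
         equienergetic C (Ebd (complement (iter_line k G)))
                         (Ebd (complement (iter_line k H))))
      <->
      (forall G H, F G -> F H ->
         spectral_radius C (complement (iter_line k G)) =
         spectral_radius C (complement (iter_line k H))))).
Proof.
case: k hk => [//|k] _ /=.
have energyE G : admissible C k.+1 G -> (0 < gorder (iter_line k.+1 G))%N ->
    energy C (Ebd (complement (iter_line k.+1 G))) =
      2 * (2 * (max_eigenvalue C (complement (iter_line k.+1 G)) + 1)
           + 3 * (gsize (iter_line k G))%:R - 4 * (gorder (iter_line k G))%:R).
  case=> rho mult L_gt0.
  rewrite (energy_Ebd_complement_line rho L_gt0) gorder_line_graph.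
  (* Carried from integers to [C], the hypothesis gives multiplicity [m - n], and
     [4(m - n) - m = 3m - 4n]. *)
  have := congr1 (fun z : int => z%:~R : C) mult.
  rewrite rmorphB /= -!pmulrn => ->.
  by ring.
split=> // n m F admF.
have orderE G : F G -> gorder (complement (iter_line k.+1 G)) = m.
  by case/admF=> _ _ <-; apply: gorder_line_graph.
have order_EbdE G :
    F G -> gorder (Ebd (complement (iter_line k.+1 G))) = (m + m)%N.
  by move=> FG; rewrite /gorder card_sum -(orderE G FG).
(* The energy formula requires a vertex; for [m = 0] all spectra are empty and both sides of the
   equivalence hold. *)
have [m0|m_gt0] := posnP m.
  have spectrum0 G : gorder G = 0%N -> spectrum C G = [::].
    move=> G0; apply: size0nil.
    rewrite (perm_size (perm_spectrum_eigenvalues C G)) size_map.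
    by rewrite -cardE card_ord.
  split=> _ G H FG FH.
    by rewrite /spectral_radius !spectrum0 ?orderE.
  split; rewrite ?order_EbdE //.
  by rewrite /energy !spectrum0 ?order_EbdE ?m0.
have radiusE G : F G -> spectral_radius C (complement (iter_line k.+1 G)) =
    max_eigenvalue C (complement (iter_line k.+1 G)).
  by move=> FG; apply: spectral_radiusE; rewrite orderE.
have energy_iff G H : F G -> F H ->
    energy C (Ebd (complement (iter_line k.+1 G))) =
    energy C (Ebd (complement (iter_line k.+1 H))) <->
    max_eigenvalue C (complement (iter_line k.+1 G)) =
    max_eigenvalue C (complement (iter_line k.+1 H)).
  move=> FG FH; have oG := orderE _ FG; have oH := orderE _ FH.
  have [admG nG mG] := admF _ FG; have [admH nH mH] := admF _ FH.
  rewrite (energyE _ admG) ?(energyE _ admH); last 2 first.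
  - by rewrite [gorder _]oH.
  - by rewrite [gorder _]oG.
  move: nG mG nH mH => /= -> -> -> ->; split=> [|->//].
  (* For fixed [n] and [m] the energy is an injective affine function of the largest eigenvalue. *)
  have two_neq0 : 2 != 0 :> C by rewrite pnatr_eq0.
  by move/(mulfI two_neq0)/addIr/addIr/(mulfI two_neq0)/addIr.
split=> [eqE G H FG FH|eqR G H FG FH].
  by rewrite !radiusE //; apply/energy_iff => //; case: (eqE G H FG FH).
split; first by rewrite !order_EbdE.
by apply/energy_iff=> //; rewrite -!radiusE //; apply: eqR.
Qed.
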